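(* Let $X,Y,Z$ be locally convex Hausdorff topological vector spaces, $K\subset Y$ a proper closed convex cone with $\operatorname{int}K\neq\emptyset$, $S\subset Z$ a nonempty convex cone, and $\Phi\colon X\times Z\to Y^\infty$ a proper $K$-convex mapping with $0_Z\in\pi(\operatorname{dom}\Phi)$, where $\pi(x,z)=z$. Consider the statements: (a) $\operatorname{epi}\Phi(\cdot,0_Z)^*=\bigcup_{T\in\mathcal L_\Phi}\operatorname{epi}\Phi^*(\cdot,T)$; (b) $\operatorname{epi}\Phi(\cdot,0_Z)^*=\bigcup_{T\in\mathcal L_\Phi^+}\operatorname{epi}\Phi^*(\cdot,T)$; (e) stable strong duality holds for the pair $(\mathrm P)-(\mathrm D)$, i.e. $\operatorname{WInf}(\mathrm P^L)=\operatorname{WMax}(\mathrm D^L)$ for every $L\in\mathcal L(X,Y)$; (f) stable strong duality holds for the pair $(\mathrm P)-(\mathrm D_\ell)$, i.e. $\operatorname{WInf}(\mathrm P^L)=\operatorname{WMax}(\mathrm D^L_\ell)$ for every $L\in\mathcal L(X,Y)$. Then (a) is equivalent to (e), and (b) is equivalent to (f).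
   Context: Ordering: $K$ proper means $K\ne Y$. $y_1<_K y_2$ iff $y_1-y_2\in-\operatorname{int}K$. $Y^\infty=Y\cup\{+\infty_Y\}$, $Y^\bullet=Y\cup\{-\infty_Y,+\infty_Y\}$, where $-\infty_Y<_K y<_K+\infty_Y$ for $y\in Y$, $-\infty_Y<_K+\infty_Y$, $-(\pm\infty_Y)=\mp\infty_Y$, $y+(\pm\infty_Y)=\pm\infty_Y$ for $y\in Y$. For $M\subset Y^\bullet$: $\operatorname{WSup}M$ is the set of $\bar v\in Y^\bullet$ such that $\bar v\not<_K v$ for all $v\in M$ and for every $\tilde v\in Y^\bullet$ with $\tilde v<_K\bar v$ there is $v\in M$ with $\tilde v<_K v$; $\operatorname{WInf}M=-\operatorname{WSup}(-M)$; $\operatorname{WMax}M=M\cap\operatorname{WSup}M$. $\mathcal L(X,Y)$ is the space of continuous linear maps $X\to Y$. $\operatorname{dom}\Phi=\{(x,z):\Phi(x,z)\neq+\infty_Y\}$; $\Phi$ is proper if $\operatorname{dom}\Phi\neq\emptyset$ (the value $-\infty_Y$ is not taken); $\Phi$ is $K$-convex if $\{(x,z,y)\in X\times Z\times Y:y\in\Phi(x,z)+K\}$ is convex. Conjugates: $\Phi^*(L,T)=\operatorname{WSup}\{L(x)+T(z)-\Phi(x,z):(x,z)\in X\times Z\}$ for $(L,T)\in\mathcal L(X,Y)\times\mathcal L(Z,Y)$; $\Phi(\cdot,0_Z)^*(L)=\operatorname{WSup}\{L(x)-\Phi(x,0_Z):x\in X\}$. $\operatorname{epi}\Phi(\cdot,0_Z)^*=\{(L,y)\in\mathcal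 L(X,Y)\times Y:y\in\Phi(\cdot,0_Z)^*(L)+K\}$ and $\operatorname{epi}\Phi^*(\cdot,T)=\{(L,y)\in\mathcal L(X,Y)\times Y:y\in\Phi^*(L,T)+K\}$ (where $\{\pm\infty_Y\}+K=\{\pm\infty_Y\}$). $\mathcal L_\Phi=\{T\in\mathcal L(Z,Y):\exists L\in\mathcal L(X,Y),\ \Phi^*(L,T)\neq\{+\infty_Y\}\}$, $\mathcal L_+(S,K)=\{T\in\mathcal L(Z,Y):T(S)\subset K\}$, $\mathcal L_\Phi^+=\mathcal L_\Phi\cap\mathcal L_+(S,K)$. Problems, for $L\in\mathcal L(X,Y)$: $\operatorname{WInf}(\mathrm P^L)=\operatorname{WInf}\{\Phi(x,0_Z)-L(x):x\in X\}$; $\operatorname{WMax}(\mathrm D^L)=\operatorname{WMax}M_L$ with $M_L=\bigcup_{T\in\mathcal L_\Phi}(-\Phi^*(L,T))$; $\operatorname{WMax}(\mathrm D^L_\ell)=\operatorname{WMax}M_L^+$ with $M_L^+=\bigcup_{T\in\mathcal L_\Phi^+}(-\Phi^*(L,T))$. $(\mathrm P),(\mathrm D),(\mathrm D_\ell)$ are the problems with $L=0$.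
   Formalization: The formal theorem additionally assumes that L_Φ is nonempty; without it the claim fails, e.g. for Φ(x,z)=f(x) with f a discontinuous linear functional, where (a) and (b) hold as ∅=∅ but WInf(P^L)={-∞} differs from WMax ∅=∅. *)

(* Defs.v *)
From HB Require Import structures.
From mathcomp Require Import all_boot all_order all_algebra.
From mathcomp Require Import all_classical all_reals all_analysis.

Set Implicit Arguments.
Unset Strict Implicit.
Unset Printing Implicit Defensive.

Import Order.TTheory GRing.Theory Num.Theory.
Import numFieldTopology.Exports.

Local Open Scope classical_set_scope.
Local Open Scope ring_scope.

Record contLinear (R : realType) (X Y : tvsType R) := ContLinear {
  contLinear_val :> {linear X -> Y};
  contLinear_continuous : continuous contLinear_val }.

(* Scaling by positive scalars only: a cone need not contain the origin. *)
Definition is_cone (R : realType) (E : lmodType R) (C : set E) : Prop :=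
  forall (a : R) x, 0 < a -> C x -> C (a *: x).

Section WeakOrder.
Context (R : realType) (Y : tvsType R) (K : set Y).

(* The extended space Y^\bullet is [\bar Y]; the library's [-%E] and [+%E] on it
   obey the conventions on infinities used here; one summand is always finite
   below, so the library's value of (+oo) + (-oo) is never used. *)
Definition ltK (u v : \bar Y) : Prop :=
  match u, v with
  | y1%:E, y2%:E => (-%R @` K°)%classic (y1 - y2)%R
  | -oo, _%:E | _%:E, +oo | -oo, +oo => True
  | _, _ => False
  end%E.

Definition WSup (M : set (\bar Y)) : set (\bar Y) :=
  [set v | (forall w, M w -> ~ ltK v w) /\
           (forall u, ltK u v -> exists2 w, M w & ltK u w)].

Definition WInf (M : set (\bar Y)) : set (\bar Y) :=
  -%E @` WSup (-%E @` M).

Definition WMax (M : set (\bar Y)) : set (\bar Y) := M `&` WSup M.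

Definition addK (M : set (\bar Y)) : set (\bar Y) :=
  [set (v + k%:E)%E | v in M & k in K].

End WeakOrder.

Section Conjugates.
Context (R : realType) (X Y Z : tvsType R) (K : set Y).

Definition fconj (f : X -> \bar Y) (L : contLinear X Y) : set (\bar Y) :=
  WSup K (range (fun x => ((L x)%:E - f x)%E)).

Definition epi (F : contLinear X Y -> set (\bar Y)) : set (contLinear X Y * Y) :=
  [set p | addK K (F p.1) p.2%:E].

Variable Phi : X * Z -> \bar Y.

Definition edom : set (X * Z) := [set p | Phi p <> +oo%E].

(* The first conjunct says that Phi takes its values in Y^\infty. *)
Definition proper_map : Prop :=
  (forall p, Phi p <> -oo%E) /\ edom !=set0.

Definition Kconvex : Prop :=
  convex_set [set p : X * Z * Y | addK K [set Phi p.1] p.2%:E].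

Definition pconj (L : contLinear X Y) (T : contLinear Z Y) : set (\bar Y) :=
  WSup K (range (fun p => ((L p.1 + T p.2)%:E - Phi p)%E)).

Definition LPhi : set (contLinear Z Y) :=
  [set T | exists L : contLinear X Y, pconj L T <> [set +oo%E]].

Definition Lplus (S : set Z) : set (contLinear Z Y) :=
  [set T | T @` S `<=` K].

Definition LPhiplus (S : set Z) : set (contLinear Z Y) := LPhi `&` Lplus S.

Definition primal_WInf (L : contLinear X Y) : set (\bar Y) :=
  WInf K (range (fun x => (Phi (x, 0%R) - (L x)%:E)%E)).

Definition dual_values (A : set (contLinear Z Y)) (L : contLinear X Y) :
    set (\bar Y) :=
  \bigcup_(T in A) (-%E @` pconj L T).

(* If [A] is empty, the right-hand side is [WMax K set0 = set0], whereas the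
   left-hand side is never empty: this fails for every [L]. *)
Definition stable_strong_duality (A : set (contLinear Z Y)) : Prop :=
  forall L : contLinear X Y, primal_WInf L = WMax K (dual_values A L).

Definition epi_representation (A : set (contLinear Z Y)) : Prop :=
  epi (fconj (fun x => Phi (x, 0))) = \bigcup_(T in A) epi (pconj ^~ T).

End Conjugates.

(* Main.v *)
(* Call y a weak upper bound (wub) of M if no element of M is strictly above y.
   As soon as M has a finite element, the finite part of WSup M + K is exactly
   the set of weak upper bounds of M, so that the epigraph representation says:
   every weak upper bound of U_L = {L x - Phi (x, 0)} is, for some T in A, a
   weak upper bound of the larger set V_(L,T) = {L x + T z - Phi (x, z)}.
   Stable strong duality says the same for the weakly minimal upper bounds, and
   every weak upper bound dominates a minimal one. If U_L is
   unbounded, both optimal values are -oo once A is nonempty, which the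
   representation forces since some U_L is bounded. *)
Require Import Defs.
From mathcomp Require Import all_boot all_order all_algebra.
From mathcomp Require Import all_classical all_reals all_analysis.
From mathcomp Require Import ring lra.

Set Implicit Arguments.
Unset Strict Implicit.
Unset Printing Implicit Defensive.

Import Order.TTheory GRing.Theory Num.Theory.
Import numFieldTopology.Exports.
Local Open Scope classical_set_scope.
Local Open Scope ring_scope.

Section ClosedConvexCone.
Context (R : realType) (Y : tvsType R) (K : set Y).
Hypotheses (K_closed : closed K) (K_convex : convex_set K) (K_cone : is_cone K).
Hypothesis K_int : K° !=set0.

(** * Interior of a closed convex cone *)

Lemma cvg_addZ_at_right (v w : Y) : v + r *: w @[r --> (0 : R)^'+] --> v.
Proof.
have scale_cvg0 : r *: w @[r --> (0 : R)^'+] --> (0 : Y).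
  rewrite -[X in _ --> X](scale0r w); apply: cvg_at_right_filter.
  apply: (@continuous2_cvg _ R^o Y Y _ _ id (fun=> w) (fun r y => r *: y) 0 w).
  - exact: (@scale_continuous R Y (0, w)).
  - exact: cvg_id.
  - exact: cvg_cst.
rewrite -[X in _ --> X](addr0 v).
apply: (@continuous2_cvg _ Y Y Y _ _ (fun=> v) (fun r => r *: w) +%R v 0).
- exact: (@add_continuous Y (v, 0)).
- exact: cvg_cst.
- exact: scale_cvg0.
Qed.

Lemma cone_addr_closed (a b : Y) : K a -> K b -> K (a + b).
Proof.
move=> Ka Kb.
have half0 : (0 : R) <= 2^-1 by lra.
have half1 : 2^-1 <= (1 : R) by lra.
have := K_convex (Itv01 half0 half1) (mem_set Ka) (mem_set Kb).
rewrite inE => /(K_cone (ltr0n R 2)).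
have -> : conv (Itv01 half0 half1) (a : convex_lmodType Y) b =
          2^-1 *: (a + b).
  by rewrite scalerDr; congr (_ *: _ + _ *: _); rewrite /unstable.onem /=; lra.
by rewrite scalerA mulfV ?scale1r ?pnatr_eq0.
Qed.

(** As [is_cone] scales by positive numbers only, the origin comes from closedness: it is the limit
    of [r *: e] in [K]. *)
Lemma cone0 : K 0.
Proof.
have [e /interior_subset Ke] := K_int.
apply: (closed_cvg _ K_closed _ _ (@cvg_addZ_at_right 0 e)).
by near=> r; rewrite add0r; apply: K_cone.
Unshelve. all: by end_near.
Qed.

Lemma interior_addr_cone (a b : Y) : K° a -> K b -> K° (a + b).
Proof.
rewrite /interior /= => /(nbhsB b).
rewrite addrC => h Kb; move: h; apply: filterS => _ [c Kc <-].
exact: cone_addr_closed.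
Qed.

Lemma interior_scale (r : R) (a : Y) : 0 < r -> K° a -> K° (r *: a).
Proof.
move=> r0 /(nbhsZ (lt0r_neq0 r0)); apply: filterS => _ [c Kc <-].
exact: K_cone.
Qed.

Lemma interior_absorbing (a v : Y) :
  K° a -> exists2 r : R, 0 < r & K° (a + r *: v).
Proof.
move=> Ka; near ((0 : R)^'+) => r; exists r.
  by near: r; exact: nbhs_right_gt.
near: r; apply: (@cvg_addZ_at_right a v K°).
by apply: open_nbhs_nbhs; split => //; exact: open_interior.
Unshelve. all: by end_near.
Qed.

(** * Weak upper bounds and weak suprema *)

Lemma ltKE (y1 y2 : Y) : ltK K y1%:E y2%:E <-> K° (y2 - y1).
Proof.
split=> [[k Kk eq_k]|Kk]; last by exists (y2 - y1) => //; rewrite opprB.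
by rewrite -opprB -eq_k opprK.
Qed.

Definition wub (M : set (\bar Y)) (y : Y) := forall w, M w -> ~ ltK K y%:E w.

Lemma wubP (M : set (\bar Y)) (y : Y) :
  ~ wub M y -> exists2 w, M w & ltK K y%:E w.
Proof. by move=> /existsNP[w /not_implyP[Mw /contrapT]]; exists w. Qed.

Lemma wub_subset (M N : set (\bar Y)) (y : Y) : M `<=` N -> wub N y -> wub M y.
Proof. by move=> MN Ny w /MN; exact: Ny. Qed.

Lemma leK_ltK_trans (y k : Y) (w : \bar Y) :
  K k -> ltK K (y + k)%:E w -> ltK K y%:E w.
Proof.
case: w => //= w Kk /ltKE Kw; apply/ltKE.
rewrite (_ : w - y = w - (y + k) + k); first exact: interior_addr_cone.
by rewrite opprD addrA subrK.
Qed.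

Lemma wub_addr_cone (M : set (\bar Y)) (y k : Y) :
  K k -> wub M y -> wub M (y + k).
Proof. by move=> Kk My w Mw /(leK_ltK_trans Kk); exact: My. Qed.

Lemma WSup_wub (M : set (\bar Y)) (s : Y) : WSup K M s%:E -> wub M s.
Proof. by case. Qed.

(** Since [K°] is open, a strict inequality survives a small shift in any direction. *)
Lemma ltK_absorbing (y v : Y) (w : \bar Y) :
  ltK K y%:E w -> exists2 r : R, 0 < r & ltK K (y + r *: v)%:E w.
Proof.
case: w => [w| |]// => [/ltKE Kw|_]; last by exists 1.
have [r r0 Kr] := interior_absorbing (- v) Kw; exists r => //; apply/ltKE.
by rewrite opprD addrA -scalerN.
Qed.

Section FiniteElement.
Variables (M : set (\bar Y)) (u0 : Y).
Hypothesis Mu0 : M u0%:E.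

Lemma WSupNy : ~ WSup K M -oo%E.
Proof. by case=> /(_ _ Mu0) h _; exact: h. Qed.

(* Slide [y] down along an interior direction [e] as long as it stays a weak
   upper bound; the last point reached is weakly minimal. *)
Lemma wub_WSup (y : Y) : wub M y -> exists2 s, WSup K M s%:E & K (y - s).
Proof.
move=> My; have [e Ke] := K_int; have Ke' := interior_subset Ke.
pose T := [set t : R | 0 <= t /\ wub M (y - t *: e)].
have T0 : T 0 by split=> //; rewrite scale0r subr0.
have supT : has_sup T.
  split; first by exists 0.
  (* For [t > r^-1] the point [y - t *: e] is strictly below [u0]: [u0 - y + r^-1 *: e] is [r^-1]
     times an interior point. *)
  have [r r0 Kr] := interior_absorbing (u0 - y) Ke.
  exists r^-1 => t [_ Mt]; apply: contrapT => /negP; rewrite -ltNge => rt.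
  apply: (Mt _ Mu0); apply: (@leK_ltK_trans _ ((t - r^-1) *: e)).
    by apply: K_cone => //; rewrite subr_gt0.
  rewrite -addrA -scaleNr -scalerDl; apply/ltKE.
  rewrite (_ : _ - _ = r^-1 *: (e + r *: (u0 - y))).
    by apply: interior_scale; rewrite ?invr_gt0.
  rewrite scalerDr scalerA mulVf ?lt0r_neq0// scale1r opprD addrA addrC.
  by rewrite -scaleNr; congr (_ *: _ + _); ring.
have sup_ge0 : 0 <= sup T by exact: sup_upper_bound.
exists (y - sup T *: e); last first.
  rewrite opprB addrC subrK; move: sup_ge0; rewrite le_eqVlt => /predU1P[<-|].
    by rewrite scale0r; exact: cone0.
  by move=> /K_cone; exact.
(* A [w] strictly above the last point would also be strictly above [y - t *: e] for some [t] in [T]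
   near [sup T]. *)
split=> [w Mw /(ltK_absorbing e)[r r0 Kr]|].
  have [t [_ Mt] rt] := sup_adherent r0 supT.
  apply: (Mt _ Mw); apply: (@leK_ltK_trans _ ((t - (sup T - r)) *: e)).
    by apply: K_cone => //; rewrite subr_gt0.
  rewrite -addrA -scaleNr -scalerDl (_ : - t + _ = - sup T + r); last by ring.
  by rewrite scalerDl addrA scaleNr.
(* A finite [u] strictly below the last point is still below [y - (sup T + r) *: e] for a small
   [r > 0], where the bound already fails. *)
move=> [u /(ltK_absorbing e)[r r0 Kr]| //|_]; last by exists u0%:E.
have : ~ wub M (y - (sup T + r) *: e).
  move=> Mr; have : sup T + r <= sup T.
    exact: (sup_upper_bound supT (conj (addr_ge0 sup_ge0 (ltW r0)) Mr)).
  by apply/negP; rewrite -ltNge ltrDl.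
move=> /wubP[w Mw Kw]; exists w => //.
move: Kr => /ltKE/interior_subset/leK_ltK_trans; apply.
rewrite (_ : u + _ = y - (sup T + r) *: e)//.
by rewrite opprD addrCA [u + (_ - _)]addrA subrr add0r scalerDl opprD addrA.
Qed.

Lemma addK_WSup (y : Y) : addK K (WSup K M) y%:E <-> wub M y.
Proof.
split=> [[[s| |] Ms] [k Kk]//= [<-]|/wub_WSup[s Ms Ks]].
  by apply: wub_addr_cone => //; exact: WSup_wub.
by exists s%:E => //; exists (y - s) => //; congr EFin; rewrite addrCA subrr addr0.
Qed.

Lemma WSup_unbounded : ~ (exists y, wub M y) -> WSup K M = [set +oo%E].
Proof.
move=> Mub; apply/seteqP; split=> [[s /WSup_wub Ms| //|/WSupNy//]|_ ->].
  by case: Mub; exists s.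
split=> [[r| |] _ []|[y| |] // _]; last by exists u0%:E.
by apply: wubP => My; apply: Mub; exists y.
Qed.

End FiniteElement.

(** * Epigraph representation and strong duality *)

Section Duality.
Variables (X Z : tvsType R) (Phi : X * Z -> \bar Y).
Hypotheses (Phi_proper : proper_map Phi) (Phi_dom0 : (snd @` edom Phi) 0).

Definition primal_set (L : contLinear X Y) : set (\bar Y) :=
  range (fun x => ((L x)%:E - Phi (x, 0%R))%E).

Definition dual_set (L : contLinear X Y) (T : contLinear Z Y) : set (\bar Y) :=
  range (fun p => ((L p.1 + T p.2)%:E - Phi p)%E).

Lemma primal_set_finite L : exists u, primal_set L u%:E.
Proof.
have [[x z] /= Phix z0] := Phi_dom0; rewrite {z}z0 in Phix.
case Phixr : (Phi (x, 0)) => [y| |]; last by case: (Phi_proper.1 (x, 0)).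
  by exists (L x - y), x => //; rewrite Phixr.
by case: Phix.
Qed.

Lemma primal_set_sub L T : primal_set L `<=` dual_set L T.
Proof.
move=> _ [x _ <-]; exists (x, 0) => //=.
by rewrite linear0 addr0.
Qed.

Lemma primal_WInfE L : primal_WInf K Phi L = -%E @` WSup K (primal_set L).
Proof.
congr (-%E @` WSup K _); rewrite /primal_set image_comp; congr (_ @` _).
by apply/funext => x /=; case: (Phi (x, 0)) => [y| |] //=; rewrite opprB.
Qed.

(** Each dual set contains the primal set (take [z = 0]), so only the inclusion of the left-hand
    epigraph in the union has content. *)
Lemma epi_representationP A :
  epi_representation K Phi A <->
  forall L y, wub (primal_set L) y -> exists2 T, A T & wub (dual_set L T) y.
Proof.
have epiU L y : epi K (fconj K (fun x => Phi (x, 0))) (L, y) <->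
    wub (primal_set L) y.
  by have [u Uu] := primal_set_finite L; exact: (addK_WSup Uu).
have epiV T L y : epi K ((pconj K Phi) ^~ T) (L, y) <-> wub (dual_set L T) y.
  have [u Uu] := primal_set_finite L.
  exact: (addK_WSup (primal_set_sub T Uu)).
split=> [repA L y /epiU|repA].
  by rewrite repA => -[T AT /epiV]; exists T.
apply/seteqP; split=> [[L y] /epiU/repA[T AT /epiV]|[L y] [T AT /epiV Vy]].
  by exists T.
by apply/epiU; apply: wub_subset Vy; exact: primal_set_sub.
Qed.

Lemma stable_strong_dualityP A : (exists L y, wub (primal_set L) y) ->
  epi_representation K Phi A <-> stable_strong_duality K Phi A.
Proof.
move=> [L0 [y0 Uy0]]; split=> [/epi_representationP repA L|dualA].
- have [T0 AT0 _] := repA _ _ Uy0.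
  have [u Uu] := primal_set_finite L.
  rewrite primal_WInfE.
  have [[y Uy]|Uub] := pselect (exists y, wub (primal_set L) y).
    have [s Us _] := wub_WSup Uu Uy.
    (* Witnesses of minimality over the primal set lie in the dual set too, so [s'] stays weakly
       minimal there. *)
    have attained s' : WSup K (primal_set L) s'%:E ->
        dual_values K Phi A L (- s')%:E.
      move=> [Us1 Us2]; have [T AT Vs] := repA _ _ Us1.
      exists T => //; exists s'%:E => //; split=> // w /Us2[v Uv wv].
      by exists v => //; exact: primal_set_sub.
    apply/seteqP; split=> [_ [[v| |] Uv <-]|].
    + split; first exact: attained.
      split=> [_ [T AT [[m| |] Vm <-]]|w]; last by exists (- v)%:E => //; exact: attained.
      * move=> /ltKE; rewrite opprK addrC => /ltKE/Uv.2[w /(primal_set_sub T)].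
        exact: Vm.1.
      * by [].
      * by have := WSupNy (primal_set_sub T Uu) Vm.
    + by have [//|w Uw] := Uv.2 y%:E; move=> /(Uy _ Uw).
    + by have := WSupNy Uu Uv.
    + move=> _ [[T AT [[v| |] Vv <-]] [Mv _]].
      * exists v%:E => //; split=> [|[w| |] // wv]; last by exists u%:E.
          exact: wub_subset (@primal_set_sub L T) (WSup_wub Vv).
        (* If [w] bounded the primal set, a minimal [s'] below it would give a dual value [- s']
           strictly above [- v], against maximality. *)
        apply: wubP => /(wub_WSup Uu)[s' /attained Ms' Ks'].
        move: wv => /ltKE vw; apply: (Mv _ Ms'); apply/ltKE.
        rewrite opprK addrC (_ : v - s' = v - w + (w - s')).
          exact: interior_addr_cone.
        by rewrite addrA subrK.
      * by case: (Mv _ (attained _ Us)).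
      * by have := WSupNy (primal_set_sub T Uu) Vv.
  (* Every dual set is now unbounded as well, so all dual values are -oo; [T0] shows that there is
     one. *)
  have WSupV T : WSup K (dual_set L T) = [set +oo%E].
    apply: (WSup_unbounded (primal_set_sub T Uu)) => -[y Vy]; apply: Uub.
    by exists y; apply: wub_subset Vy; exact: primal_set_sub.
  have -> : dual_values K Phi A L = [set -oo%E].
    apply/seteqP; split=> [_ [T _ [v Vv <-]]|_ ->].
      by move: Vv; rewrite /pconj WSupV => ->.
    by exists T0 => //; exists +oo%E => //; rewrite /pconj WSupV.
  rewrite (WSup_unbounded Uu Uub) image_set1.
  apply/seteqP; split=> [_ ->|_ [-> _]//].
  by split=> //; split => [_ ->|[]].
- apply/epi_representationP => L y Uy.
  have [u Uu] := primal_set_finite L.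
  (* Duality is used at a minimal bound [s]; the [T] it yields also serves [y], since [y - s] is in
     [K]. *)
  have [s Us Ks] := wub_WSup Uu Uy.
  have : primal_WInf K Phi L (- s)%:E by rewrite primal_WInfE; exists s%:E.
  rewrite dualA => -[[T AT [[v| |] // Vv [/oppr_inj vs]]] _].
  exists T => //; rewrite -(subrK s y) addrC; apply: wub_addr_cone => //.
  by rewrite -vs; exact: WSup_wub.
Qed.

End Duality.
End ClosedConvexCone.

(* [LPhi_nonempty] cannot be dropped: for a discontinuous linear functional f
   and Phi (x, z) = f x, LPhi is empty, both epigraphs in the first (and second)
   representation are empty, but WInf = [set -oo] differs from WMax set0 = set0. *)
Theorem theorem4p2 (R : realType) (X Y Z : tvsType R)
    (hX : hausdorff_space X) (hY : hausdorff_space Y) (hZ : hausdorff_space Z)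
    (K : set Y) (K_proper : K <> setT) (K_closed : closed K)
    (K_convex : convex_set K) (K_cone : is_cone K) (K_int : K° !=set0)
    (S : set Z) (S_nonempty : S !=set0)
    (S_convex : convex_set S) (S_cone : is_cone S)
    (Phi : X * Z -> \bar Y) (Phi_proper : proper_map Phi)
    (Phi_convex : Kconvex K Phi)
    (Phi_dom0 : (snd @` edom Phi) 0)
    (LPhi_nonempty : LPhi K Phi !=set0) :
  (epi_representation K Phi (LPhi K Phi) <->
     stable_strong_duality K Phi (LPhi K Phi)) /\
  (epi_representation K Phi (LPhiplus K Phi S) <->
     stable_strong_duality K Phi (LPhiplus K Phi S)).
Proof.
have [L0 [T0 V0]] : exists L T, pconj K Phi L T <> [set +oo%E].
  by have [T [L V]] := LPhi_nonempty; exists L, T.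
have [u Uu] := primal_set_finite Phi_proper Phi_dom0 L0.
(* Without a weak upper bound the conjugate would be +oo alone, contradicting the choice of [L0] and
   [T0]. *)
have [y Vy] : exists y, wub K (dual_set Phi L0 T0) y.
  apply: contrapT => Vub; apply: V0.
  exact: (WSup_unbounded (primal_set_sub T0 Uu) Vub).
have Uub : exists L y, wub K (primal_set Phi L) y.
  by exists L0, y; apply: wub_subset Vy; exact: primal_set_sub.
by split; exact: stable_strong_dualityP.
Qed.
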